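(* (1) Let $\mu$ be a measure on the unit ball $\mathbb{B}^n\subset\mathbb{R}^n$ which satisfies Lusin's condition (N), and let $A\subseteq\mathbb{B}^n$ be a $\mu$-measurable set such that $0<\mu(A)<+\infty$. Then the function $$G(x)=-\int_A\log\frac{(1-|x|^2)(1-|y|^2)}{|x-y|^2+(1-|y|^2)(1-|x|^2)}\,d\mu(y),\qquad x\in\mathbb{B}^n,$$ has a unique minimum in $\mathbb{B}^n$. (2) Let $\mu$ be a measure on the unit ball $\mathbb{B}_m\subset\mathbb{C}^m$ which satisfies Lusin's condition (N), and let $A\subseteq\mathbb{B}_m$ be a $\mu$-measurable set such that $0<\mu(A)<+\infty$. Then the function $$L(z)=-\int_A\log\frac{(1-|z|^2)(1-|w|^2)}{|1-\langle z,w\rangle|^2}\,d\mu(w),\qquad z\in\mathbb{B}_m,$$ has a unique minimum in $\mathbb{B}_m$.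
   Context: $\mathbb{B}^n=\{x\in\mathbb{R}^n:|x|<1\}$ and $\mathbb{B}_m=\{z\in\mathbb{C}^m:|z|<1\}$ are the open unit balls, with Euclidean norm $|\cdot|$; on $\mathbb{C}^m$, $\langle z,w\rangle=\sum_{k=1}^m z_k\overline{w_k}$ and $|z|=\sqrt{\langle z,z\rangle}$. Measures are defined on the Borel $\sigma$-algebra of the ball. Lusin's condition (N): for every Borel set $D$ in the ball, if $\mu(D)=0$ then $\mu(g(D))=0$ for every Möbius transformation $g$ of $\mathbb{B}^n$ onto itself (in the case of $\mathbb{B}^n$), respectively for every holomorphic automorphism $g$ of $\mathbb{B}_m$ (in the case of $\mathbb{B}_m$). Möbius transformations of $\mathbb{B}^n$ onto itself are the maps $T\circ h_a$ with $T$ an orthogonal transformation of $\mathbb{R}^n$, $a\in\mathbb{B}^n$, and $$h_a(x)=\frac{a|x-a|^2+(1-|a|^2)(a-x)}{|x-a|^2+(1-|a|^2)(1-|x|^2)}.$$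
   Formalization: The formal theorem additionally assumes that G (respectively L) is finite at some point of the ball; otherwise it can be identically +∞ even though 0<μ(A)<+∞, and then every point is a minimum. *)

(* Defs.v *)
From HB Require Import structures.
From mathcomp Require Import all_boot all_order all_algebra.
From mathcomp Require Import complex.
From mathcomp Require Import all_classical all_reals all_analysis.

Set Implicit Arguments.
Unset Strict Implicit.
Unset Printing Implicit Defensive.

Import Order.TTheory GRing.Theory Num.Theory.
Import numFieldTopology.Exports numFieldNormedType.Exports.

Local Open Scope classical_set_scope.
Local Open Scope ring_scope.

(* The library's topology and norm on an abstract numClosedFieldType are not
   inferred for the concrete type R[i]; these are the same structures. *)
HB.instance Definition _ (R : realType) := PseudoPointedMetric.copy R[i] R[i]^o.
HB.instance Definition _ (R : realType) := NormedModule.copy R[i] R[i]^o.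

Notation borel T := (g_sigma_algebraType (@open T)).

Section euclidean.
Variable R : realType.

(* The library norm `|x| on 'rV[R]_n is the sup norm. *)
Definition enorm n (x : 'rV[R]_n) : R := Num.sqrt (\sum_(k < n) x 0 k ^+ 2).

Definition herm m (z w : 'rV[R[i]]_m) : R[i] :=
  \sum_(k < m) z 0 k * (w 0 k)^*%C.

(* herm z z is a nonnegative real, so taking its real part loses nothing. *)
Definition hnorm m (z : 'rV[R[i]]_m) : R := Num.sqrt (complex.Re (herm z z)).

Lemma enorm0 n : enorm (0 : 'rV[R]_n) = 0.
Proof. by rewrite /enorm big1 ?sqrtr0// => k _; rewrite mxE expr0n. Qed.

Lemma hnorm0 m : hnorm (0 : 'rV[R[i]]_m) = 0.
Proof. by rewrite /hnorm /herm big1 ?sqrtr0// => k _; rewrite !mxE mul0r. Qed.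

Definition rball n : Type := [set x : 'rV[R]_n | enorm x < 1].

Definition cball m : Type := [set z : 'rV[R[i]]_m | hnorm z < 1].

Definition rval n : rball n -> 'rV[R]_n := set_val.
Definition cval m : cball m -> 'rV[R[i]]_m := set_val.

HB.instance Definition _ n := Topological.copy (rball n)
  (set_type [set x : 'rV[R]_n | enorm x < 1]).
HB.instance Definition _ m := Topological.copy (cball m)
  (set_type [set z : 'rV[R[i]]_m | hnorm z < 1]).

Lemma rball0_subproof n :
  (0 : 'rV[R]_n) \in [set x : 'rV[R]_n | enorm x < 1].
Proof. by rewrite inE /= enorm0 ltr01. Qed.

Lemma cball0_subproof m :
  (0 : 'rV[R[i]]_m) \in [set z : 'rV[R[i]]_m | hnorm z < 1].
Proof. by rewrite inE /= hnorm0 ltr01. Qed.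

HB.instance Definition _ n :=
  isPointed.Build (rball n) (exist _ 0 (rball0_subproof n)).
HB.instance Definition _ m :=
  isPointed.Build (cball m) (exist _ 0 (cball0_subproof m)).

Definition moebius_h n (a x : 'rV[R]_n) : 'rV[R]_n :=
  (enorm (x - a) ^+ 2 + (1 - enorm a ^+ 2) * (1 - enorm x ^+ 2))^-1 *:
  (enorm (x - a) ^+ 2 *: a + (1 - enorm a ^+ 2) *: (a - x)).

(* Vectors are rows, so the orthogonal matrix T acts on the right. *)
Definition moebius n (g : rball n -> rball n) : Prop :=
  exists (T : 'M[R]_n) (a : rball n), T *m T^T = 1%:M /\
    forall x : rball n, rval (g x) = moebius_h (rval a) (rval x) *m T.

(* differentiable is Frechet differentiability over the scalar field of the
   normed module, here R[i].  The values of f outside the open ball are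
   irrelevant. *)
Definition holomorphic m (g : cball m -> cball m) : Prop :=
  exists f : 'rV[R[i]]_m -> 'rV[R[i]]_m,
    (forall z : cball m, differentiable f (cval z)) /\
    (forall z : cball m, cval (g z) = f (cval z)).

Definition holomorphic_automorphism m (g : cball m -> cball m) : Prop :=
  holomorphic g /\
  exists h : cball m -> cball m, [/\ cancel g h, cancel h g & holomorphic h].

End euclidean.

Definition lusinN d (T : measurableType d) (R : realType)
    (mu : {measure set T -> \bar R}) (transf : set (T -> T)) : Prop :=
  forall D : set T, measurable D -> mu D = 0%E ->
  forall g : T -> T, transf g -> mu (g @` D) = 0%E.

(* The argument of ln lies in ]0, 1], so the integrand is nonpositive and the
   potentials below are well defined with values in [0, +oo]; they are +oo
   everywhere as soon as they are +oo somewhere. *)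
Definition potentialG (R : realType) n
    (mu : {measure set (borel (rball R n)) -> \bar R})
    (A : set (borel (rball R n))) (x : rball R n) : \bar R :=
  (- \int[mu]_(y in A)
     (ln ((1 - enorm (rval x) ^+ 2) * (1 - enorm (rval y) ^+ 2) /
          (enorm (rval x - rval y) ^+ 2 +
           (1 - enorm (rval y) ^+ 2) * (1 - enorm (rval x) ^+ 2))))%:E)%E.

Definition potentialL (R : realType) m
    (mu : {measure set (borel (cball R m)) -> \bar R})
    (A : set (borel (cball R m))) (z : cball R m) : \bar R :=
  (- \int[mu]_(w in A)
     (ln ((1 - hnorm (cval z) ^+ 2) * (1 - hnorm (cval w) ^+ 2) /
          ComplexField.Normc.normc (1 - herm (cval z) (cval w)) ^+ 2))%:E)%E.

Definition has_unique_minimum (R : realType) (T : Type) (F : T -> \bar R) :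
  Prop := exists! x0 : T, forall x : T, (F x0 <= F x)%E.

(* Main.v *)
(** Both integrands are increasing functions of a kernel [k >= 1] which is the
    hyperbolic cosine of a distance: [ln (k ^ 2)] on the complex ball, and
    [ln ((1 + k) / 2)] on the real ball, whose points [x] are sent to the real
    points [2 x / (1 + |x|^2)] of the complex ball (Klein model).  With the
    lifts [(1, z)] to Lorentz space, [k z w] is
    [|1 - <z, w>| / sqrt ((1 - |z|^2) (1 - |w|^2))], and all that is used of its
    geometry is the sign of the Gram determinant of three lifts.  It gives a
    Harnack inequality, hence finiteness, continuity and, through a
    quasi-triangle inequality integrated over [A], coercivity of the potential;
    so a minimum exists by compactness.  It also gives strict convexity: the
    sum of two normalized lifts, with phases adjusted, is a midpoint [u] with
    [k u w ^ 2 < k z w * k z' w] for all [w], hence uniqueness. *)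

Require Import Defs.
From HB Require Import structures.
From mathcomp Require Import all_boot all_order all_algebra.
From mathcomp Require Import complex.
From mathcomp Require Import all_classical all_reals all_analysis.
From mathcomp Require Import measurable_realfun ring lra.

Set Implicit Arguments.
Unset Strict Implicit.
Unset Printing Implicit Defensive.

Import Order.TTheory GRing.Theory Num.Theory.
Import numFieldTopology.Exports numFieldNormedType.Exports.

Local Open Scope classical_set_scope.
Local Open Scope ring_scope.

(** * Minima of integrated kernels *)

Lemma continuous_borel_measurable (R : realType) (T : ptopologicalType)
    (f : T -> R) (D : set (borel T)) :
  continuous f -> measurable D -> measurable_fun D (f : borel T -> R).
Proof.
move=> /continuousP cf mD; apply: (measurability _ (RGenOpens.measurableE R)).
move=> _ [_ [a [b ->] <-]]; apply: measurableI => //.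
by apply: sub_sigma_algebra; apply: cf; exact: interval_open.
Qed.

Section potential_minimum.
Variables (R : realType) (T : ptopologicalType).
(** [phi] is a kernel on the logarithmic scale and [delta] a distance-like bound on its variation.
    Since [delta_le] bounds [delta] by [phi] up to a constant, [phi_le] becomes a quasi-triangle
    inequality for [phi] itself. *)
Variables (phi delta : T -> T -> R) (C : R) (o : T).
Hypothesis phi_ge0 : forall x y, 0 <= phi x y.
Hypothesis phiC : forall x y, phi x y = phi y x.
Hypothesis deltaC : forall x y, delta x y = delta y x.
Hypothesis phi_le : forall x x' y, phi x y <= phi x' y + delta x x'.
Hypothesis delta_le : forall x y, delta x y <= phi x y + C.
Hypothesis delta_cvg : forall x, delta x y @[y --> x] --> (0 : R).
Hypothesis phi_compact : forall N, compact [set x | phi o x <= N].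
Hypothesis phi_mid : forall x x', x <> x' ->
  exists z, forall y, phi z y < (phi x y + phi x' y) / 2.

Let delta_ge0 x y : 0 <= delta x y.
Proof.
by have := phi_le x y y; have := phi_le y x y; rewrite (deltaC y x); lra.
Qed.

(** Exchanging [x] and [y] bounds the distance of [f x] and [f y] by [delta x y * c], which tends to
    0. It serves for [phi x] with [c = 1] and for the potential with [c] the measure of [A]. *)
Lemma delta_dist_continuous (f : T -> R) (c : R) :
  (forall x y, f x <= f y + delta x y * c) -> continuous f.
Proof.
move=> fle x; apply/cvgrPdist_le => e e0.
have c1 : 0 < `|c| + 1 by rewrite ltr_wpDl.
have /cvgrPdist_le/(_ _ (divr_gt0 e0 c1)) := @delta_cvg x; apply: filterS => y.
rewrite sub0r normrN => /(le_trans (ler_norm _)).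
rewrite ler_pdivlMr// => dxy.
have := fle x y; have := fle y x; rewrite (deltaC y x).
have : delta x y * c <= e.
  apply: le_trans dxy; rewrite ler_wpM2l// (le_trans (ler_norm _))//; lra.
rewrite ler_norml; lra.
Qed.

Lemma phi_continuous x : continuous (phi x).
Proof.
by apply: (@delta_dist_continuous _ 1) => y y'; rewrite mulr1 !(phiC x).
Qed.

Variables (mu : {measure set (borel T) -> \bar R}) (A : set (borel T)).
Hypothesis mA : measurable A.
Hypothesis A_gt0 : (0 < mu A)%E.
Hypothesis A_fin : (mu A < +oo)%E.

Let F x : \bar R := (\int[mu]_(y in A) (phi x y)%:E)%E.
Hypothesis F_fin : exists x, (F x < +oo)%E.

Let mphi x : measurable_fun A (fun y : borel T => (phi x y)%:E).
Proof.
by apply/measurable_EFinP; exact: continuous_borel_measurable (@phi_continuous x) mA.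
Qed.

Let M := fine (mu A).
Let ME : mu A = M%:E.
Proof. by rewrite fineK// ge0_fin_numE. Qed.
Let M_gt0 : 0 < M.
Proof. by rewrite -lte_fin -ME. Qed.

Let F_ge0 x : (0 <= F x)%E.
Proof. by apply: integral_ge0 => y _; rewrite lee_fin. Qed.

Let F_le x x' : (F x <= F x' + (delta x x' * M)%:E)%E.
Proof.
rewrite EFinM -ME -(integral_cst _ mA) -ge0_integralD//=; last 2 first.
- by move=> y _; rewrite lee_fin.
- by move=> y _; rewrite lee_fin.
apply: ge0_le_integral => //.
- by move=> y _; rewrite lee_fin.
- exact: emeasurable_funD.
- by move=> y _; rewrite -EFinD lee_fin.
Qed.

(** Two values of the potential differ by at most [delta x x0 * M], so finiteness spreads from one
    point to all. *)
Let F_fin_num x : F x \is a fin_num.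
Proof.
have [x0 x0fin] := F_fin; rewrite ge0_fin_numE//.
by apply: le_lt_trans (F_le x x0) _; rewrite lte_add_pinfty// ltry.
Qed.

Let f x := fine (F x).
Let FE x : F x = (f x)%:E. Proof. by rewrite fineK. Qed.

Let f_continuous : continuous f.
Proof.
by apply: (@delta_dist_continuous _ M) => x y; rewrite -lee_fin EFinD -!FE.
Qed.

(** Integrate the quasi-triangle inequality [phi o x <= phi x y + phi o y + C] over [y] in [A]. The
    constant is replaced by its absolute value so that every integrand is nonnegative. *)
Let f_coercive x : phi o x * M <= f x + f o + `|C| * M.
Proof.
rewrite -lee_fin !EFinD !EFinM -!FE -ME -!(integral_cst _ mA).
have phi_ge0E x0 y : A y -> (0 <= (phi x0 y)%:E)%E by move=> _; rewrite lee_fin.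
rewrite -(ge0_integralD mu mA (phi_ge0E x) (mphi x) (phi_ge0E o) (mphi o)).
rewrite -ge0_integralD//=; last 2 first.
- by move=> y Ay; apply: adde_ge0; exact: phi_ge0E.
- exact: emeasurable_funD.
apply: ge0_le_integral => //.
- by move=> y _; rewrite lee_fin.
- by apply: emeasurable_funD => //; exact: emeasurable_funD.
move=> y _; rewrite -!EFinD lee_fin.
have := phi_le x y o; have := delta_le x y; have := ler_norm C.
rewrite (phiC o x) (phiC o y); lra.
Qed.

(** The strict pointwise inequality of [phi_mid] survives integration: were the integral of the gap
    [g] zero, [g] would vanish almost everywhere on [A], and [A] would be null. *)
Let f_mid x x' : x <> x' -> exists z, f z < (f x + f x') / 2.
Proof.
move=> /phi_mid[z zlt]; exists z.
have g_gt0 y : 0 < (phi x y + phi x' y) / 2 - phi z y by rewrite subr_gt0.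
pose g y := ((phi x y + phi x' y) / 2 - phi z y)%:E.
have mg : measurable_fun A (g : borel T -> \bar R).
  apply/measurable_EFinP; apply: continuous_borel_measurable => //.
  move=> y; apply: cvgB; last exact: phi_continuous.
  by apply: cvgMl; apply: cvgD; exact: phi_continuous.
have g_gt : (0 < \int[mu]_(y in A) g y)%E.
  rewrite lt_neqAle integral_ge0 ?andbT; last first.
    by move=> y _; rewrite lee_fin ltW.
  apply/eqP => g0.
  have /(ae_eq_integral_abs _ mA mg) : (\int[mu]_(y in A) `|g y|)%E = 0.
    rewrite [RHS]g0; apply: eq_integral => y _.
    by rewrite gee0_abs// lee_fin ltW.
  move=> [N [mN N0 AN]]; move: A_gt0; rewrite ltNge => /negP; apply.
  rewrite -N0 le_measure ?inE// => y Ay; apply: AN => /= /(_ Ay)[] gy0.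
  by move: (g_gt0 y); rewrite gy0 ltxx.
have g_ge0 y : A y -> (0 <= g y)%E by move=> _; rewrite lee_fin ltW.
have phi_ge0E x0 y : A y -> (0 <= (phi x0 y)%:E)%E by move=> _; rewrite lee_fin.
(* A doubled identity between sums of nonnegative integrals avoids subtraction in the extended
   reals; it also rules out an infinite integral of [g]. *)
have gE : (F z + F z + (\int[mu]_(y in A) g y + \int[mu]_(y in A) g y) =
    F x + F x')%E.
  rewrite -(ge0_integralD mu mA (phi_ge0E x) (mphi x) (phi_ge0E x') (mphi x')).
  rewrite -(ge0_integralD mu mA (phi_ge0E z) (mphi z) (phi_ge0E z) (mphi z)).
  rewrite -(ge0_integralD mu mA g_ge0 mg g_ge0 mg) -ge0_integralD//=; first last.
  - exact: emeasurable_funD.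
  - by move=> y Ay; apply: adde_ge0; exact: g_ge0.
  - exact: emeasurable_funD.
  - by move=> y Ay; apply: adde_ge0; exact: phi_ge0E.
  by apply: eq_integral => y _; rewrite -!EFinD; congr EFin; field.
move: gE g_gt; rewrite !FE; case: (\int[mu]_(y in A) g y)%E => [r| |]//=.
by rewrite -!EFinD lte_fin => -[]; lra.
Qed.

Lemma potential_unique_minimum : has_unique_minimum F.
Proof.
(* Chosen so that, by coercivity, [phi o x > c0] forces [f x > f o]: the minimum over this compact
   sublevel set, which contains [o], is global. *)
pose c0 := (2 * f o + `|C| * M) / M.
have Ko : phi o o <= c0.
  by rewrite ler_pdivlMr//; have := f_coercive o; lra.
have [||c cK cmin] := @compact_EVT_min _ _ f _ _ (@phi_compact c0).
- by exists o.
- exact: continuous_subspaceT.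
have c_min x : f c <= f x.
  have [xK|xK] := leP (phi o x) c0; first by apply: cmin; rewrite inE.
  have : f c <= f o by apply: cmin; rewrite inE.
  move: xK; rewrite ltr_pdivrMr// => xK.
  have := f_coercive x; lra.
exists c; split => [x|x xmin]; first by rewrite !FE lee_fin.
apply: contrapT => /f_mid[z].
have := c_min z; have := c_min x; have := xmin c; rewrite !FE !lee_fin; lra.
Qed.

End potential_minimum.

(* [k] is to be thought of as the hyperbolic cosine of a distance: [k_gram] says
   that the Gram determinant of three points of a hyperboloid is nonnegative. *)
Section hyperbolic_kernel.
Variables (R : realType) (T : ptopologicalType) (k : T -> T -> R) (o : T).
Hypothesis k_ge1 : forall x y, 1 <= k x y.
Hypothesis kC : forall x y, k x y = k y x.
Hypothesis k_gram : forall x x' y,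
  k x y ^+ 2 + k x' y ^+ 2 + k x x' ^+ 2 <= 1 + 2 * k x x' * k x y * k x' y.
Hypothesis k_cvg : forall x, k x y @[y --> x] --> (1 : R).
Hypothesis k_compact : forall N, compact [set x | k o x <= N].
Hypothesis k_mid : forall x x', x <> x' ->
  exists z, forall y, k z y ^+ 2 < k x y * k x' y.

(* The exponential of the distance whose hyperbolic cosine is [k x y]. *)
Definition expdist x y := k x y + Num.sqrt (k x y ^+ 2 - 1).

Lemma expdist_ge1 x y : 1 <= expdist x y.
Proof. by rewrite -[1]addr0 lerD// sqrtr_ge0. Qed.

Lemma expdist_le x y : expdist x y <= 2 * k x y.
Proof.
have k1 := k_ge1 x y; rewrite mulrDl mul1r lerD2l.
have k0 : 0 <= k x y by rewrite (le_trans ler01).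
by rewrite -[leRHS](ger0_norm k0) -sqrtr_sqr ler_wsqrtr// lerBlDr lerDl.
Qed.

Lemma expdistC x y : expdist x y = expdist y x.
Proof. by rewrite /expdist kC. Qed.

Lemma expdist_cvg x : expdist x y @[y --> x] --> (1 : R).
Proof.
have -> : (1 : R) = 1 + Num.sqrt (1 ^+ 2 - 1).
  by rewrite expr1n subrr sqrtr0 addr0.
apply: cvgD; first exact: k_cvg.
apply: continuous_cvg; first exact: sqrt_continuous.
apply: cvgB; last exact: cvg_cst.
by under eq_cvg do rewrite expr2; rewrite expr2; apply: cvgM; exact: k_cvg.
Qed.

(** Write [p], [q], [c] for [k x y], [k x' y], [k x x']. Completing the square in [p], the Gram
    inequality reads [(p - c * q) ^ 2 <= (c ^ 2 - 1) * (q ^ 2 - 1)], whose right side is at most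
    [(c ^ 2 - 1) * q ^ 2]. *)
Lemma kernel_harnack x x' y : k x y <= expdist x x' * k x' y.
Proof.
have p1 := k_ge1 x y; have q1 := k_ge1 x' y; have c1 := k_ge1 x x'.
have := k_gram x x' y.
rewrite /expdist; set p := k x y in p1 *; set q := k x' y in q1 *.
set c := k x x' in c1 * => gram.
rewrite mulrDl -lerBlDl; apply: le_trans (ler_norm _) _.
have q0 : 0 <= q by lra.
have c2 : 0 <= c ^+ 2 - 1 by rewrite subr_ge0 exprn_ege1.
have -> : Num.sqrt (c ^+ 2 - 1) * q = Num.sqrt ((c ^+ 2 - 1) * q ^+ 2).
  by rewrite sqrtrM// sqrtr_sqr ger0_norm.
rewrite -sqrtr_sqr ler_wsqrtr//.
nra.
Qed.

Variables (mu : {measure set (borel T) -> \bar R}) (A : set (borel T)).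
Hypothesis mA : measurable A.
Hypothesis A_gt0 : (0 < mu A)%E.
Hypothesis A_fin : (mu A < +oo)%E.

(** All hypotheses on [phi] are logarithms of squared statements on [k]: Harnack gives [phi_le], the
    factor 2 in [expdist_le] gives the constant [ln (2 ^+ 2)], and the geometric mean in [k_mid]
    becomes an arithmetic one. *)
Lemma ln_kernel_unique_minimum :
  (exists x, (\int[mu]_(y in A) (ln (k x y ^+ 2))%:E < +oo)%E) ->
  has_unique_minimum (fun x => \int[mu]_(y in A) (ln (k x y ^+ 2))%:E)%E.
Proof.
have k_gt0 x y : 0 < k x y by rewrite (lt_le_trans ltr01).
have D_gt0 x y : 0 < expdist x y by rewrite (lt_le_trans ltr01)// expdist_ge1.
have k_ge0 x y : 0 <= k x y by exact: ltW.
have D_ge0 x y : 0 <= expdist x y by exact: ltW.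
apply: (@potential_unique_minimum _ _ _ (fun x y => ln (expdist x y ^+ 2))
  (ln (2 ^+ 2)) o) => //.
- by move=> x y; rewrite ln_ge0// exprn_ege1.
- by move=> x y; rewrite kC.
- by move=> x y; rewrite expdistC.
- move=> x x' y; rewrite -lnM ?posrE ?exprn_gt0// ler_ln ?posrE ?mulr_gt0 ?exprn_gt0//.
  rewrite -exprMn ler_sqr ?nnegrE ?mulr_ge0 ?k_ge0 ?D_ge0// mulrC.
  exact: kernel_harnack.
- move=> x y; rewrite -lnM ?posrE ?exprn_gt0// ler_ln ?posrE ?mulr_gt0 ?exprn_gt0//.
  by rewrite -exprMn ler_sqr ?nnegrE ?mulr_ge0 ?k_ge0 ?D_ge0// mulrC expdist_le.
- move=> x; rewrite -(@ln1 R); apply: continuous_cvg; first exact: continuous_ln.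
  under eq_cvg do rewrite expr2; rewrite -[1](mulr1 1).
  by apply: cvgM; exact: expdist_cvg.
- move=> N; have := @k_compact (expR (N / 2)); congr compact.
  apply/seteqP; split => x /=.
  + move=> kN; rewrite -[N]expRK ler_ln ?posrE ?exprn_gt0 ?expR_gt0//.
    rewrite (_ : N = N / 2 * 2); last by field.
    by rewrite expRM_natr ler_sqr ?nnegrE ?expR_ge0 ?k_ge0.
  + rewrite lnXn// -[X in X <= N]mulr_natr -ler_pdivlMr// => kN.
    by rewrite -(@lnK _ (k o x)) ?posrE// ler_expR.
- move=> x x' /k_mid[z zlt]; exists z => y.
  have k2_gt0 u v : 0 < k u v ^+ 2 by rewrite exprn_gt0.
  rewrite -lnM ?posrE// ltr_pdivlMr// mulr_natr -lnXn//.
  rewrite ltr_ln ?posrE ?exprn_gt0 ?mulr_gt0// -exprMn.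
  by rewrite ltr_sqr ?nnegrE ?mulr_ge0 ?exprn_ge0.
Qed.

(** If [k] is the hyperbolic cosine of [d], then [(1 + k) / 2] is the squared hyperbolic cosine of
    [d / 2], so [delta] is now [d] and not [2 * d]. Harnack passes from [k] to [1 + k] because
    [expdist] is at least 1. *)
Lemma ln_half_kernel_unique_minimum :
  (exists x, (\int[mu]_(y in A) (ln ((1 + k x y) / 2))%:E < +oo)%E) ->
  has_unique_minimum (fun x => \int[mu]_(y in A) (ln ((1 + k x y) / 2))%:E)%E.
Proof.
have u_ge1 x y : 1 <= (1 + k x y) / 2 by have := k_ge1 x y; lra.
have u_gt0 x y : 0 < (1 + k x y) / 2 by rewrite (lt_le_trans ltr01).
have D_gt0 x y : 0 < expdist x y by rewrite (lt_le_trans ltr01)// expdist_ge1.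
apply: (@potential_unique_minimum _ _ _ (fun x y => ln (expdist x y)) (ln 4) o)
  => //.
- by move=> x y; rewrite ln_ge0.
- by move=> x y; rewrite kC.
- by move=> x y; rewrite expdistC.
- move=> x x' y; rewrite -lnM ?posrE// ler_ln ?posrE ?(mulr_gt0 (u_gt0 _ _))//.
  have := kernel_harnack x x' y; have := expdist_ge1 x x'; lra.
- move=> x y; rewrite -lnM ?posrE// ler_ln ?posrE ?(mulr_gt0 (u_gt0 _ _))//.
  have := expdist_le x y; lra.
- move=> x; rewrite -(@ln1 R); apply: continuous_cvg; first exact: continuous_ln.
  exact: expdist_cvg.
- move=> N; have := @k_compact (2 * expR N - 1); congr compact.
  apply/seteqP; split => x /= kN.
  + rewrite -[N]expRK ler_ln ?posrE ?expR_gt0//; lra.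
  + have : (1 + k o x) / 2 <= expR N by rewrite -(lnK (u_gt0 o x)) ler_expR.
    lra.
- move=> x x' /k_mid[z zlt]; exists z => y.
  rewrite -lnM ?posrE// ltr_pdivlMr// mulr_natr -lnXn//.
  rewrite ltr_ln ?posrE ?exprn_gt0 ?(mulr_gt0 (u_gt0 _ _))//.
  have := zlt y; have := k_ge1 x y; have := k_ge1 x' y; have := k_ge1 z y.
  set p := k x y; set q := k x' y; set s := k z y => s1 q1 p1 spq.
  (* The arithmetic-geometric mean inequality handles the linear terms of
     [(1 + s) ^ 2 < (1 + p) * (1 + q)]; the quadratic ones are [spq]. *)
  have s2pq : 2 * s < p + q.
    have := sqr_ge0 (p - q); rewrite sqrrB => pq.
    by rewrite -ltr_sqr ?nnegrE; lra.
  lra.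
Qed.

End hyperbolic_kernel.

(** * The complex ball *)

Section hermitian_form.
Variables (R : realType) (m : nat).
Local Notation normc := (@ComplexField.Normc.normc R).
Implicit Types (z w e : 'rV[R[i]]_m) (a b c : R[i]).

Lemma sqr_normcE c : (normc c ^+ 2)%:C%C = c * c^*%C.
Proof. by rewrite -sqr_normc normc_def rmorphXn; case: c. Qed.

Lemma real_complexM (x y : R) : (x * y)%:C%C = x%:C%C * y%:C%C.
Proof. exact: rmorphM. Qed.

Lemma real_complexB (x y : R) : (x - y)%:C%C = x%:C%C - y%:C%C.
Proof. exact: rmorphB. Qed.

Lemma conjcM a b : (a * b)^*%C = a^*%C * b^*%C.
Proof. exact: rmorphM. Qed.

Lemma normc_ge0 c : 0 <= normc c.
Proof. by case: c => x y; rewrite sqrtr_ge0. Qed.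

Lemma normcJr c : normc c^*%C = normc c.
Proof. by case: c => x y /=; rewrite sqrrN. Qed.

Lemma Re_le_normc c : complex.Re c <= normc c.
Proof.
case: c => x y /=; apply: le_trans (ler_norm _) _.
by rewrite -sqrtr_sqr ler_wsqrtr// lerDl sqr_ge0.
Qed.

Lemma normc_real (x : R) : normc x%:C%C = `|x|.
Proof. by rewrite /= expr0n addr0 sqrtr_sqr. Qed.

Lemma ReB a b : complex.Re (a - b) = complex.Re a - complex.Re b.
Proof. by case: a b => ? ? []. Qed.

Lemma ReJ c : complex.Re c^*%C = complex.Re c.
Proof. by case: c. Qed.

Lemma Re_real_mul (x : R) c : complex.Re (x%:C%C * c) = x * complex.Re c.
Proof. by case: c => u v /=; ring. Qed.

Lemma normcB_sqr a b :
  normc (a - b) ^+ 2 = normc a ^+ 2 + normc b ^+ 2 - 2 * complex.Re (a^*%C * b).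
Proof.
case: a b => x y [u v] /=.
by rewrite !sqr_sqrtr ?addr_ge0 ?sqr_ge0//; ring.
Qed.

Lemma normcD_sqr a b :
  normc (a + b) ^+ 2 = normc a ^+ 2 + normc b ^+ 2 + 2 * complex.Re (a * b^*%C).
Proof.
case: a b => x y [u v] /=.
by rewrite !sqr_sqrtr ?addr_ge0 ?sqr_ge0//; ring.
Qed.

Lemma hermDl z z' w : herm (z + z') w = herm z w + herm z' w.
Proof. by rewrite -big_split; apply: eq_bigr => k _; rewrite mxE mulrDl. Qed.

Lemma hermZl a z w : herm (a *: z) w = a * herm z w.
Proof. by rewrite mulr_sumr; apply: eq_bigr => k _; rewrite mxE mulrA. Qed.

Lemma herm_conj z w : herm w z = (herm z w)^*%C.
Proof.
rewrite /herm rmorph_sum; apply: eq_bigr => k _ /=.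
by rewrite rmorphM /= conjcK mulrC.
Qed.

Lemma hermDr z w w' : herm z (w + w') = herm z w + herm z w'.
Proof. by rewrite herm_conj hermDl rmorphD /= -!herm_conj. Qed.

Lemma hermZr a z w : herm z (a *: w) = a^*%C * herm z w.
Proof. by rewrite herm_conj hermZl rmorphM /= -herm_conj. Qed.

Lemma hermNl z w : herm (- z) w = - herm z w.
Proof. by rewrite -scaleN1r hermZl mulN1r. Qed.

Lemma hermNr z w : herm z (- w) = - herm z w.
Proof. by rewrite herm_conj hermNl rmorphN /= -herm_conj. Qed.

Lemma herm_diag z : herm z z = (\sum_(k < m) normc (z 0 k) ^+ 2)%:C%C.
Proof.
by rewrite rmorph_sum; apply: eq_bigr => k _; rewrite /= sqr_normcE.
Qed.

Lemma hnorm_sqr z : hnorm z ^+ 2 = \sum_(k < m) normc (z 0 k) ^+ 2.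
Proof.
by rewrite /hnorm sqr_sqrtr herm_diag//= sumr_ge0// => k _; rewrite sqr_ge0.
Qed.

Lemma hermE z : herm z z = (hnorm z ^+ 2)%:C%C.
Proof. by rewrite hnorm_sqr herm_diag. Qed.

Lemma hnorm_ge0 z : 0 <= hnorm z.
Proof. exact: sqrtr_ge0. Qed.

Lemma hnormD_sqr z w :
  hnorm (z + w) ^+ 2 = hnorm z ^+ 2 + hnorm w ^+ 2 + 2 * complex.Re (herm z w).
Proof.
have hnormE (y : 'rV[R[i]]_m) : hnorm y ^+ 2 = complex.Re (herm y y) by rewrite hermE.
rewrite !hnormE !(hermDl, hermDr) (herm_conj z w).
by case: (herm z z) (herm z w) (herm w w) => ? ? [? ?] [? ?] /=; ring.
Qed.

Lemma hnorm_eq0 z : hnorm z = 0 -> z = 0.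
Proof.
move=> z0; have := hnorm_sqr z; rewrite z0 expr0n/= => /esym/eqP.
rewrite psumr_eq0 => [/allP z0'|k _]; last by rewrite sqr_ge0.
apply/rowP => k; rewrite mxE; apply: ComplexField.Normc.eq0_normc; apply/eqP.
by have := z0' k; rewrite mem_index_enum sqrf_eq0 => /(_ isT).
Qed.

Lemma hnormZ a z : hnorm (a *: z) = normc a * hnorm z.
Proof.
apply/eqP; rewrite -(@eqrXn2 _ 2) ?hnorm_ge0 ?mulr_ge0 ?normc_ge0 ?hnorm_ge0//.
rewrite exprMn !hnorm_sqr mulr_sumr; apply/eqP; apply: eq_bigr => k _.
by rewrite mxE ComplexField.Normc.normcM exprMn.
Qed.

Lemma herm_cauchy_schwarz z w : normc (herm z w) <= hnorm z * hnorm w.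
Proof.
have [w0|w_neq0] := eqVneq (hnorm w) 0.
  rewrite w0 mulr0 (hnorm_eq0 w0) -(scale0r z) hermZr rmorph0 mul0r.
  by rewrite ComplexField.Normc.normc0.
have w_gt0 : 0 < hnorm w by rewrite lt_neqAle eq_sym w_neq0 hnorm_ge0.
pose c := herm z w; pose b := (hnorm w ^+ 2)%:C%C.
(* The test vector is [hnorm w ^ 2] times the component of [z] orthogonal to [w]. *)
have : 0 <= hnorm (b *: z - c *: w) ^+ 2 by rewrite sqr_ge0.
have -> : hnorm (b *: z - c *: w) ^+ 2 =
    hnorm w ^+ 2 * (hnorm w ^+ 2 * hnorm z ^+ 2 - normc c ^+ 2).
  have bJ : b^*%C = b by exact: conjc_real.
  apply: complexI; rewrite 2?[in RHS](real_complexM (hnorm w ^+ 2)) real_complexB.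
  rewrite (real_complexM (hnorm w ^+ 2)) sqr_normcE -!hermE (hermE w) -/b.
  rewrite !(hermDl, hermDr, hermNl, hermNr, hermZl, hermZr).
  by rewrite bJ (herm_conj z w) -/c (hermE w) -/b; ring.
rewrite pmulr_rge0 ?exprn_gt0// subr_ge0 -exprMn mulrC.
by rewrite ler_sqr ?nnegrE ?normc_ge0 ?mulr_ge0 ?hnorm_ge0.
Qed.

End hermitian_form.

(** * Lorentz geometry of the complex ball *)

Section complex_ball_kernel.
Variables (R : realType) (m : nat).
Local Notation normc := (@ComplexField.Normc.normc R).
Implicit Types (z w : 'rV[R[i]]_m) (a b c : R[i]).

Definition defect z : R := 1 - hnorm z ^+ 2.
(* The Lorentz product of the lifts [(1, z)] and [(1, w)]. *)
Definition lorentz z w : R[i] := 1 - herm z w.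
Definition ckernel z w : R :=
  normc (lorentz z w) / Num.sqrt (defect z * defect w).

Lemma defect_gt0 z : (0 < defect z) = (hnorm z < 1).
Proof. by rewrite subr_gt0 expr_lt1// hnorm_ge0. Qed.

Lemma lorentzC z w : lorentz w z = (lorentz z w)^*%C.
Proof. by rewrite /lorentz herm_conj rmorphB rmorph1. Qed.

Lemma lorentz_diag z : lorentz z z = (defect z)%:C%C.
Proof. by rewrite /lorentz hermE real_complexB. Qed.

(* Both sides are [- defect w] times the Lorentz product of the projections of
   [(1, z)] and [(1, z')] orthogonally to [(1, w)], where the product is negative
   definite. *)
Lemma lorentz_gram_defect z z' w :
  lorentz z w * (lorentz z' w)^*%C - (defect w)%:C%C * lorentz z z' =
  herm (z - w) w * (herm (z' - w) w)^*%C
    + (defect w)%:C%C * herm (z - w) (z' - w).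
Proof.
rewrite -lorentzC -lorentz_diag -herm_conj /lorentz.
by rewrite !(hermDl, hermDr, hermNl, hermNr); ring.
Qed.

(** The case [z' = z] of the previous identity: a reversed Cauchy-Schwarz inequality with explicit
    excess. The excess yields [ckernel_ge1], the limit of the kernel on the diagonal and the
    strictness of the midpoint inequality. *)
Lemma normc_lorentz_sqr z w :
  normc (lorentz z w) ^+ 2 =
  defect z * defect w + (normc (herm (z - w) w) ^+ 2 + defect w * hnorm (z - w) ^+ 2).
Proof.
have := lorentz_gram_defect z z w; rewrite lorentz_diag hermE -!sqr_normcE.
by rewrite -!real_complexM -real_complexB -rmorphD/= => /complexI; lra.
Qed.

(** Apply Cauchy-Schwarz to the positive form on the right of [lorentz_gram_defect], at [z - w] and
    [z' - w]. After expansion the product of the two squared moduli cancels, and one factor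
    [defect w] divides out. *)
Lemma lorentz_gram z z' w : 0 < defect w ->
  defect w * normc (lorentz z z') ^+ 2 + defect z' * normc (lorentz z w) ^+ 2
    + defect z * normc (lorentz z' w) ^+ 2 <=
  defect z * defect z' * defect w + 2 *
    complex.Re ((lorentz z w * (lorentz z' w)^*%C)^*%C * lorentz z z').
Proof.
move=> w1.
have := normc_lorentz_sqr z' w; have := normc_lorentz_sqr z w.
have := herm_cauchy_schwarz (z - w) (z' - w).
have := lorentz_gram_defect z z' w.
set P := lorentz z w; set Q := lorentz z' w; set k := lorentz z z'.
set x := herm (z - w) w; set y := herm (z' - w) w.
set g := herm (z - w) (z' - w).
have := hnorm_ge0 (z - w); have := hnorm_ge0 (z' - w).
set a := hnorm (z - w); set b := hnorm (z' - w) => b0 a0 PQk gab P2 Q2.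
have D_le : normc (P * Q^*%C - (defect w)%:C%C * k) <=
    normc x * normc y + defect w * (a * b).
  rewrite PQk (le_trans (le_normcD _ _))// !ComplexField.Normc.normcM.
  by rewrite normcJr normc_real gtr0_norm// lerD2l ler_pM2l.
have : normc (P * Q^*%C - (defect w)%:C%C * k) ^+ 2 <=
    (normc x ^+ 2 + defect w * a ^+ 2) * (normc y ^+ 2 + defect w * b ^+ 2).
  apply: (@le_trans _ _ ((normc x * normc y + defect w * (a * b)) ^+ 2)).
    by rewrite ler_sqr ?nnegrE ?normc_ge0// (le_trans (normc_ge0 _) D_le).
  (* This is exactly the difference of the two sides, by Lagrange's identity. *)
  have : 0 <= defect w * (normc x * b - normc y * a) ^+ 2.
    by rewrite mulr_ge0 ?sqr_ge0// ltW.
  lra.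
rewrite normcB_sqr !ComplexField.Normc.normcM normcJr normc_real gtr0_norm//.
have -> : complex.Re ((P * Q^*%C)^*%C * ((defect w)%:C%C * k)) =
    defect w * complex.Re ((P * Q^*%C)^*%C * k).
  by rewrite mulrCA Re_real_mul.
set D := complex.Re _.
have -> : normc x ^+ 2 + defect w * a ^+ 2 =
  normc P ^+ 2 - defect z * defect w by rewrite P2; ring.
have -> : normc y ^+ 2 + defect w * b ^+ 2 =
  normc Q ^+ 2 - defect z' * defect w by rewrite Q2; ring.
by move=> PQk2; rewrite -(ler_pM2l w1); lra.
Qed.

(** The Lorentz square of [a (1, z) + b (1, z')], a vector with first coordinate [a + b]. *)
Lemma lorentz_combination a b z z' :
  normc (a + b) ^+ 2 - hnorm (a *: z + b *: z') ^+ 2 =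
  normc a ^+ 2 * defect z + normc b ^+ 2 * defect z'
    + 2 * complex.Re (a * b^*%C * lorentz z z').
Proof.
rewrite normcD_sqr hnormD_sqr !hnormZ hermZl hermZr /defect /lorentz.
have -> : complex.Re (a * b^*%C * (1 - herm z z')) =
    complex.Re (a * b^*%C) - complex.Re (a * (b^*%C * herm z z')).
  by rewrite mulrBr mulr1 -mulrA ReB.
ring.
Qed.

Lemma ckernelC z w : ckernel z w = ckernel w z.
Proof. by rewrite /ckernel lorentzC normcJr mulrC (mulrC (defect w)) mulrC. Qed.

Lemma ckernel_ge1 z w : 0 < defect z -> 0 < defect w -> 1 <= ckernel z w.
Proof.
move=> z1 w1; have zw0 : 0 < defect z * defect w by exact: mulr_gt0.
rewrite ler_pdivlMr ?sqrtr_gt0// mul1r -[leRHS]ger0_norm ?normc_ge0//.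
rewrite -sqrtr_sqr ler_wsqrtr// normc_lorentz_sqr lerDl addr_ge0 ?sqr_ge0//.
by rewrite mulr_ge0 ?sqr_ge0// ltW.
Qed.

Lemma ckernel_sqr z w : 0 < defect z -> 0 < defect w ->
  ckernel z w ^+ 2 = normc (lorentz z w) ^+ 2 / (defect z * defect w).
Proof.
by move=> z1 w1; rewrite /ckernel expr_div_n sqr_sqrtr// ltW// mulr_gt0.
Qed.

Lemma ckernelM z z' w : 0 < defect z -> 0 < defect z' -> 0 < defect w ->
  ckernel z w * ckernel z' w = normc (lorentz z w) * normc (lorentz z' w) /
    (Num.sqrt (defect z) * Num.sqrt (defect z') * defect w).
Proof.
move=> z1 z'1 w1; have [[z0 z'0] w0] := (ltW z1, ltW z'1, ltW w1).
rewrite /ckernel !sqrtrM// -{3}(sqr_sqrtr w0).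
by field; rewrite !gt_eqF ?sqrtr_gt0.
Qed.

(** Divide [lorentz_gram] by the three defects; bounding the real part of the triple product by its
    modulus removes the phases. *)
Lemma ckernel_gram z z' w : 0 < defect z -> 0 < defect z' -> 0 < defect w ->
  ckernel z w ^+ 2 + ckernel z' w ^+ 2 + ckernel z z' ^+ 2 <=
  1 + 2 * ckernel z z' * ckernel z w * ckernel z' w.
Proof.
move=> z1 z'1 w1; have := lorentz_gram z z' w1.
set D := complex.Re _ => gram.
have DPQ : D <= normc (lorentz z z') * normc (lorentz z w) * normc (lorentz z' w).
  apply: le_trans (Re_le_normc _) _; rewrite !ComplexField.Normc.normcM.
  by rewrite !normcJr !ComplexField.Normc.normcM normcJr mulrC mulrA.
have [[z0 z'0] w0] := (ltW z1, ltW z'1, ltW w1).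
rewrite /ckernel !expr_div_n !sqr_sqrtr ?mulr_ge0// !sqrtrM//.
move: gram DPQ; set p := normc _; set q := normc _; set k := normc _.
move: (sqr_sqrtr z0) (sqr_sqrtr z'0) (sqr_sqrtr w0).
move: (z1) (z'1) (w1); rewrite -(sqrtr_gt0 (defect z)) -(sqrtr_gt0 (defect z')).
rewrite -(sqrtr_gt0 (defect w)).
set x := Num.sqrt _; set y := Num.sqrt _; set v := Num.sqrt _.
move=> x0 y0 v0 <- <- <- gram DPQ.
rewrite -subr_ge0 (_ : _ - _ = (x ^+ 2 * y ^+ 2 * v ^+ 2 + 2 * (p * q * k)
  - (v ^+ 2 * p ^+ 2 + y ^+ 2 * q ^+ 2 + x ^+ 2 * k ^+ 2)) / (x * y * v) ^+ 2).
  by rewrite divr_ge0 ?sqr_ge0//; lra.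
by field; rewrite !gt_eqF.
Qed.

(* [a] and [b] are the weights normalizing the lifts of [z] and [z'], up to a
   common factor; the phase [c] makes the product of the two lifts positive. *)
Lemma ckernel_midpoint z z' c (a := (Num.sqrt (defect z'))%:C%C)
    (b := c * (Num.sqrt (defect z))%:C%C)
    (u := (a + b)^-1 *: (a *: z + b *: z')) :
  0 < defect z -> 0 < defect z' -> z <> z' ->
  normc c = 1 -> lorentz z z' = c * (normc (lorentz z z'))%:C%C ->
  0 < defect u /\ forall w, 0 < defect w ->
    ckernel u w ^+ 2 < ckernel z w * ckernel z' w.
Proof.

move=> z1 z'1 zz' c1 ck; have [z0 z'0] := (ltW z1, ltW z'1).
pose x := Num.sqrt (defect z); pose y := Num.sqrt (defect z').
have x0 : 0 < x by rewrite sqrtr_gt0.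
have y0 : 0 < y by rewrite sqrtr_gt0.
have x2 : x ^+ 2 = defect z by rewrite sqr_sqrtr.
have y2 : y ^+ 2 = defect z' by rewrite sqr_sqrtr.
pose k := normc (lorentz z z').
have xyk : x * y < k.
  rewrite -ltr_sqr ?nnegrE ?normc_ge0 ?mulr_ge0 ?ltW// exprMn x2 y2.
  rewrite /k normc_lorentz_sqr ltrDl ltr_wpDl ?sqr_ge0// mulr_gt0//.
  rewrite exprn_gt0// lt_neqAle eq_sym hnorm_ge0 andbT.
  by apply: contra_not_neq zz' => /hnorm_eq0/subr0_eq.
have cc : c * c^*%C = 1 by rewrite -sqr_normcE c1 expr1n.
have na : normc a ^+ 2 = y ^+ 2 by rewrite normc_real ger0_norm ?sqrtr_ge0.
have nb : normc b ^+ 2 = x ^+ 2.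
  by rewrite ComplexField.Normc.normcM c1 mul1r normc_real ger0_norm ?sqrtr_ge0.
have bJ : b^*%C = c^*%C * x%:C%C
  by rewrite /b conjcM; congr (_ * _); exact: conjc_real.
have N0 : 0 < 2 * (x * y) * (x * y + k).
  by rewrite !mulr_gt0// addr_gt0 ?mulr_gt0// (lt_trans _ xyk)// mulr_gt0.
(* Each lift contributes [x ^ 2 * y ^ 2]; in the cross term the phase of [b^*] cancels that of
   [lorentz z z'], leaving [2 * x * y * k]. *)
have combE : normc (a + b) ^+ 2 - hnorm (a *: z + b *: z') ^+ 2 =
    2 * (x * y) * (x * y + k).
  rewrite lorentz_combination na nb bJ ck -/k -x2 -y2.
  have -> : a * (c^*%C * x%:C%C) * (c * k%:C%C) = y%:C%C * (x%:C%C * k%:C%C).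
    by transitivity (y%:C%C * (x%:C%C * k%:C%C) * (c * c^*%C));
      [rewrite /a -/y; ring|rewrite cc mulr1].
  by rewrite !Re_real_mul /=; ring.
have ab0 : 0 < normc (a + b) ^+ 2.
  by rewrite (lt_le_trans N0)// -combE lerBlDr lerDl sqr_ge0.
have ab_neq0 : a + b != 0.
  by apply: contraTneq ab0 => ->; rewrite ComplexField.Normc.normc0 expr0n ltxx.
have defect_u : defect u = 2 * (x * y) * (x * y + k) / normc (a + b) ^+ 2.
  rewrite -combE /defect /u hnormZ exprMn ComplexField.Normc.normcV.
  by field; rewrite -sqrf_eq0 gt_eqF.
have lorentz_u w :
    lorentz u w = (a + b)^-1 * (a * lorentz z w + b * lorentz z' w).
  rewrite /lorentz /u hermZl hermDl !hermZl; field; exact: ab_neq0.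
have u1 : 0 < defect u by rewrite defect_u divr_gt0.
split=> // w w1; rewrite ckernel_sqr// ckernelM// lorentz_u defect_u -/x -/y.
have aE : a = y%:C%C by [].
have := lorentz_gram z z' w1; rewrite -x2 -y2 -/k; rewrite -/k in ck.
clearbody u b a x y k.
have s0 : 0 < normc (a + b).
  by rewrite lt_neqAle normc_ge0 andbT eq_sym -sqrf_eq0 gt_eqF.
rewrite ComplexField.Normc.normcM ComplexField.Normc.normcV.
move: (normc (a + b)) s0 => s s0; rewrite exprMn (normcD_sqr (a * _)).
rewrite !(ComplexField.Normc.normcM _ (lorentz _ _)).
rewrite !(exprMn _ (normc _) (normc (lorentz _ _))) na nb.
rewrite (conjcM b) bJ ck.
set P := lorentz z w; set Q := lorentz z' w.
pose d := complex.Re (c^*%C * (P * Q^*%C)).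
have -> : complex.Re ((P * Q^*%C)^*%C * (c * k%:C%C)) = k * d.
  rewrite /d -(ReJ (c^*%C * _)) -Re_real_mul !conjcM !conjcK.
  congr complex.Re.
  ring.
have -> : complex.Re (a * P * (c^*%C * x%:C%C * Q^*%C)) = x * y * d.
  rewrite aE -mulrA -!Re_real_mul; congr complex.Re.
  by rewrite real_complexM; ring.
have : d <= normc P * normc Q.
  apply: le_trans (Re_le_normc _) _; rewrite !ComplexField.Normc.normcM.
  by rewrite !normcJr c1 mul1r.
set p := normc P; set q := normc Q => dpq gram.
have xy0 : 0 < x * y by exact: mulr_gt0.
have xyk0 : 0 < x * y + k by rewrite addr_gt0// (lt_trans xy0).
rewrite ltr_pdivrMr ?mulr_gt0 ?invr_gt0 ?exprn_gt0//.
rewrite -subr_gt0 (_ : _ - _ =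
  (2 * (x * y + k) * (p * q) -
   (y ^+ 2 * p ^+ 2 + x ^+ 2 * q ^+ 2 + 2 * (x * y * d))) / s ^+ 2); last first.
  by field; rewrite !gt_eqF.
rewrite divr_gt0 ?exprn_gt0// subr_gt0.
(* Using [gram], the required gap is at least this term plus twice the next one. Strictness comes
   from [x * y < k], that is, from [z] and [z'] being distinct. *)
have : 0 < defect w * ((k - x * y) * (x * y + k)).
  by rewrite !mulr_gt0// subr_gt0.
have : 0 <= (x * y + k) * (p * q - d) by rewrite mulr_ge0 ?subr_ge0// ltW.
lra.
Qed.

End complex_ball_kernel.

(** * Compactness and continuity for the balls *)

Lemma compact_set_type (X : topologicalType) (A K : set X) :
  K `<=` A -> compact K -> compact (set_val @^-1` K : set (set_type A)).
Proof.
(* The image filter clusters at a point of [K], which belongs to the subspace because [K] lies in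
   [A]; neighborhoods there are traces of ambient ones. *)
move=> KA cK F PF FK; have [p [Kp Fp]] := cK (set_val @ F) _ FK.
exists (SigSub (mem_set (KA _ Kp))); split => // B U FB [V [[W oW <-] Wp WU]].
have [|_ [[b Bb <-] Wb]] := Fp (set_val @` B) W _ (open_nbhs_nbhs (conj oW Wp)).
  by apply: (@filterS _ F _ B) FB => b Bb; exists b.
by exists b; split => //; exact: WU.
Qed.

Section complex_topology.
Variable R : realType.
Local Notation normc := (@ComplexField.Normc.normc R).

Lemma normrE_complex (c : R[i]) : `|c| = (normc c)%:C%C.
Proof. by rewrite normc_def; case: c. Qed.

Lemma normc_dist_le (a b : R[i]) : `|normc a - normc b| <= normc (a - b).
Proof.
have tri u v : normc u - normc v <= normc (u - v).
  by rewrite lerBlDr -{1}(subrK v u) le_normcD.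
by have := tri a b; have := tri b a; rewrite -(normcN (b - a)) opprB ler_norml; lra.
Qed.

Lemma normc_continuous : continuous (normc : R[i] -> R).
Proof.
move=> a; apply/(@cvgrPdist_lt R _ _ _ (nbhs_filter (a : R[i]))) => e e0.
exists e%:C%C => [|b /=]; first by rewrite /= ltcR.
rewrite normrE_complex ltcR; exact: le_lt_trans (normc_dist_le _ _).
Qed.

Lemma real_complex_continuous : continuous (fun x : R => x%:C%C).
Proof.
move=> x; apply/cvgrPdist_lt => e e0.
(* The radius [e] is a complex number, but a positive one is real. *)
have [r re] : exists r, e = r%:C%C by apply/complex_realP; rewrite gtr0_real.
move: e0; rewrite {}re ltcR => r0.
exists r => // y /=.
by rewrite -real_complexB normrE_complex normc_real ltcR.
Qed.

(** A compact set of complex numbers containing the closed unit disc; its powers enclose the closed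
    balls. *)
Definition complex_square : set R[i] :=
  (fun p : R * R => p.1%:C%C + 'i%C * p.2%:C%C) @` (`[-1, 1] `*` `[-1, 1]).

Lemma complex_square_compact : compact complex_square.
Proof.
apply: continuous_compact; last first.
  by apply: compact_setX; exact: segment_compact.
apply: continuous_subspaceT => p; apply: cvgD.
  by apply: continuous_comp; [exact: cvg_fst|exact: real_complex_continuous].
apply: cvgMr.
by apply: continuous_comp; [exact: cvg_snd|exact: real_complex_continuous].
Qed.

Lemma normc_le1_square c : normc c <= 1 -> complex_square c.
Proof.
case: c => x y; rewrite -(@ler_sqr) ?nnegrE ?normc_ge0//.
rewrite /= sqr_sqrtr ?addr_ge0 ?sqr_ge0// expr1n => xy1.
have [x2 y2] := (sqr_ge0 x, sqr_ge0 y).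
exists (x, y) => /=; last by rewrite [RHS]complexE.
by split; rewrite /= in_itv/= -ler_norml -(@expr_le1 _ 2)// real_normK ?num_real//; lra.
Qed.

Variable m : nat.

Lemma hnormB_continuous (w : 'rV[R[i]]_m) :
  continuous (fun z : 'rV[R[i]]_m => hnorm (w - z) ^+ 2).
Proof.
rewrite (_ : (fun _ => _) = fun z : 'rV[R[i]]_m => \sum_(k < m) normc (w 0 k - z 0 k) ^+ 2).
  apply: continuous_big => [|k _ z]; first exact: add_continuous.
  have normc_cvg : normc (w 0 k - y 0 k) @[y --> z] --> normc (w 0 k - z 0 k).
    apply: continuous_cvg; first exact: normc_continuous.
    by apply: cvgB; [exact: cvg_cst|exact: coord_continuous].
  exact: (cvgM normc_cvg normc_cvg).
by apply/funext => z; rewrite hnorm_sqr; apply: eq_bigr => k _; rewrite !mxE.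
Qed.

Lemma hnorm_sqr_continuous : continuous (fun z : 'rV[R[i]]_m => hnorm z ^+ 2).
Proof.
rewrite (_ : (fun _ => _) = fun z : 'rV[R[i]]_m => hnorm (0 - z) ^+ 2).
  exact: hnormB_continuous.
apply/funext => z; rewrite sub0r !hnorm_sqr; apply: eq_bigr => k _.
rewrite mxE; congr (_ ^+ 2).
by case: (z 0 k) => x y /=; rewrite !sqrrN.
Qed.

(** A closed subset of a product of compact squares; [r < 1] keeps it inside the open ball, so
    compactness passes to the subspace. *)
Lemma hnorm_ball_compact r : r < 1 ->
  compact [set z : cball R m | hnorm (cval z) ^+ 2 <= r].
Proof.
move=> r1; pose K := [set z : 'rV[R[i]]_m | hnorm z ^+ 2 <= r].
have KA : K `<=` [set z | hnorm z < 1].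
  move=> z Kz /=; rewrite -(@expr_lt1 _ 2) ?hnorm_ge0//.
  exact: le_lt_trans Kz r1.
apply: (@compact_set_type _ _ K KA).
apply: (@subclosed_compact _ _
  [set z : 'rV[R[i]]_m | forall k, complex_square (z ord0 k)]).
- rewrite (_ : K = (fun z => hnorm z ^+ 2) @^-1` [set x | x <= r])//.
  by apply: closed_comp => [z _|]; [exact: hnorm_sqr_continuous|exact: closed_le].
- exact: (@rV_compact R[i] m (fun=> complex_square) (fun=> complex_square_compact)).
- move=> z Kz k; apply: normc_le1_square.
  rewrite -(@expr_le1 _ 2) ?normc_ge0//; apply: le_trans (ltW r1).
  apply: le_trans Kz; rewrite hnorm_sqr (bigD1 k)//= lerDl.
  by rewrite sumr_ge0// => j _; rewrite sqr_ge0.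
Qed.

End complex_topology.

(** Turns both potentials into integrals of nonnegative logarithms. The sign of [u - 1] is what
    allows negation to cross the integral without integrability. *)
Lemma oppe_integral_ln d (T : measurableType d) (R : realType)
    (mu : {measure set T -> \bar R}) (A : set T) (u v : T -> R) :
  (forall y, 1 <= u y) -> (forall y, v y = (u y)^-1) ->
  (- (\int[mu]_(y in A) (ln (v y))%:E) = \int[mu]_(y in A) (ln (u y))%:E)%E.
Proof.
move=> u1 vu; rewrite -[RHS]oppeK; congr (- _)%E.
rewrite -integral_ge0N => [|y _]; last by rewrite lee_fin ln_ge0.
apply: eq_integral => y _.
by rewrite vu lnV ?EFinN// posrE (lt_le_trans ltr01).
Qed.

Lemma cvg_one_plus_quotient (R : realType) (X : topologicalType) (x : X)
    (f g : X -> R) (c : R) :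
  continuous f -> continuous g -> f x = 0 -> c != 0 -> 1 - g x != 0 ->
  1 + f y / (c * (1 - g y)) @[y --> x] --> (1 : R).
Proof.
move=> cf cg fx0 c0 gx0; rewrite -[X in _ --> X]addr0.
rewrite -(mul0r (c * (1 - g x))^-1) -fx0.
apply: cvgD; first exact: cvg_cst.
apply: cvgM; first exact: cf.
apply: cvgV; first by rewrite mulf_neq0.
by apply: cvgMr; apply: cvgB; [exact: cvg_cst|exact: cg].
Qed.

(** * The potential on the complex ball *)

Section complex_ball.
Variables (R : realType) (m : nat).
Local Notation normc := (@ComplexField.Normc.normc R).
Local Notation k := (fun z w : cball R m => ckernel (cval z) (cval w)).

Lemma continuous_cval (f : 'rV[R[i]]_m -> R) :
  continuous f -> continuous (fun z : cball R m => f (cval z)).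
Proof.
move=> cf z; apply: (@continuous_comp _ _ _ (@cval R m)); last exact: cf.
exact: initial_continuous.
Qed.

Lemma cval_inj : injective (@cval R m).
Proof. exact: val_inj. Qed.

Lemma cball_lt1 (z : cball R m) : hnorm (cval z) < 1.
Proof. exact: set_valP z. Qed.

Lemma cball_defect (z : cball R m) : 0 < defect (cval z).
Proof. by rewrite defect_gt0 cball_lt1. Qed.

(** Squeeze between 1 and [u]: the kernel is at most its square, and Cauchy-Schwarz bounds the
    excess in [normc_lorentz_sqr] by [hnorm (z - w) ^ 2]. *)
Lemma ckernel_cvg (z : cball R m) : k z w @[w --> z] --> (1 : R).
Proof.
pose u (w : cball R m) := 1 + hnorm (cval z - cval w) ^+ 2 /
  (defect (cval z) * (1 - hnorm (cval w) ^+ 2)).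
have u_cvg : u w @[w --> z] --> (1 : R).
  apply: cvg_one_plus_quotient.
  - exact: (continuous_cval (@hnormB_continuous R m (cval z))).
  - exact: (continuous_cval (@hnorm_sqr_continuous R m)).
  - by rewrite subrr hnorm0 expr0n.
  - by rewrite gt_eqF ?cball_defect.
  - by rewrite gt_eqF ?cball_defect.
apply: (squeeze_cvgr _ (cvg_cst (1 : R)) u_cvg); apply: nearW => w.
have [z1 w1] := (cball_defect z, cball_defect w).
have k1 : 1 <= k z w by rewrite ckernel_ge1.
rewrite k1/=; apply: (@le_trans _ _ (k z w ^+ 2)); first by rewrite ler_eXnr.
rewrite ckernel_sqr// ler_pdivrMr ?mulr_gt0// mulrDl mul1r divfK; last first.
  by rewrite gt_eqF// mulr_gt0.
rewrite normc_lorentz_sqr lerD2l.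
have := herm_cauchy_schwarz (cval z - cval w) (cval w).
rewrite -ler_sqr ?nnegrE ?normc_ge0 ?mulr_ge0 ?hnorm_ge0// exprMn /defect; lra.
Qed.

Lemma ckernel0 (z : cball R m) : k point z = (Num.sqrt (defect (cval z)))^-1.
Proof.
have -> : cval (point : cball R m) = 0 by [].
rewrite /ckernel /lorentz -(scale0r 0) hermZl mul0r subr0 scale0r.
by rewrite ComplexField.Normc.normc1 /defect hnorm0 expr0n/= subr0 !mul1r.
Qed.

(** By [ckernel0], the sublevel set for [N > 0] is given by [hnorm z ^ 2 <= 1 - N ^- 2], with a
    bound below 1. *)
Lemma ckernel_compact N : compact [set z | k point z <= N].
Proof.
have [N0|N0] := leP N 0.
  rewrite (_ : [set _ | _] = set0); first exact: compact0.
  apply/seteqP; split => // z /=.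
  rewrite ckernel0 leNgt (le_lt_trans N0)//.
  by rewrite invr_gt0 sqrtr_gt0 cball_defect.
have kNE z : (k point z <= N) = (hnorm (cval z) ^+ 2 <= 1 - N ^- 2).
  have z1 := cball_defect z.
  rewrite ckernel0 invf_ple ?posrE ?sqrtr_gt0// -[LHS]ler_sqr ?nnegrE ?sqrtr_ge0//.
    by rewrite sqr_sqrtr ?(ltW z1)// exprVn /defect lerBrDr lerBrDl addrC.
  by rewrite invr_ge0 ltW.
rewrite (_ : [set z | k point z <= N] =
    [set z : cball R m | hnorm (cval z) ^+ 2 <= 1 - N ^- 2]).
  by apply: hnorm_ball_compact; rewrite ltrBlDr ltrDl invr_gt0 exprn_gt0.
by apply/seteqP; split => z /=; rewrite kNE.
Qed.

Lemma ckernel_strict_midpoint (z z' : cball R m) : z <> z' ->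
  exists u, forall w, k u w ^+ 2 < k z w * k z' w.
Proof.
move=> zz'; pose l := lorentz (cval z) (cval z').
have l0 : normc l != 0.
  have := ckernel_ge1 (cball_defect z) (cball_defect z').
  by apply: contraTneq => l0; rewrite /ckernel l0 mul0r -ltNge ltr01.
(* The phase of [l], which is nonzero because the kernel is at least 1. *)
pose c := l / (normc l)%:C%C.
have [] := @ckernel_midpoint _ _ (cval z) (cval z') c.
- exact: cball_defect.
- exact: cball_defect.
- by move=> /cval_inj.
- rewrite ComplexField.Normc.normcM ComplexField.Normc.normcV normc_real.
  by rewrite ger0_norm ?normc_ge0// divff.
- by rewrite -/l /c divfK//; apply: contra_neq l0 => /complexI.
set u := (_ + _)^-1 *: _; rewrite defect_gt0 => u1 ulr.
exists (exist _ u (mem_set u1) : cball R m) => w.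
exact: ulr (cball_defect w).
Qed.

Lemma potentialL_unique_minimum (mu : {measure set (borel (cball R m)) -> \bar R})
    (A : set (borel (cball R m))) :
  measurable A -> (0 < mu A)%E -> (mu A < +oo)%E ->
  (exists z : cball R m, (potentialL mu A z < +oo)%E) ->
  has_unique_minimum (potentialL mu A).
Proof.
move=> mA A0 Afin.
have -> : potentialL mu A =
    fun z => (\int[mu]_(w in A) (ln (k z w ^+ 2))%:E)%E.
  apply/funext => z; rewrite /potentialL.
  apply: oppe_integral_ln => w; have [z1 w1] := (cball_defect z, cball_defect w).
    by rewrite exprn_ege1// ckernel_ge1.
  by rewrite ckernel_sqr// invf_div.
apply: (@ln_kernel_unique_minimum _ _ _ point) => //.
- by move=> z w; rewrite ckernel_ge1 ?cball_defect.
- by move=> z w; rewrite ckernelC.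
- by move=> z z' w; rewrite ckernel_gram ?cball_defect.
- exact: ckernel_cvg.
- exact: ckernel_compact.
- exact: ckernel_strict_midpoint.
Qed.

End complex_ball.

(** * The real ball *)

Section klein_model.
Variables (R : realType) (n : nat).
Implicit Types x y v : 'rV[R]_n.

Definition rdot x y := \sum_(k < n) x 0 k * y 0 k.

Lemma enorm_ge0 x : 0 <= enorm x.
Proof. exact: sqrtr_ge0. Qed.

Lemma enorm_sqr x : enorm x ^+ 2 = rdot x x.
Proof.
rewrite sqr_sqrtr; last by apply: sumr_ge0 => k _; rewrite sqr_ge0.
by apply: eq_bigr => k _; rewrite expr2.
Qed.

Lemma enorm_eq0 x : enorm x = 0 -> x = 0.
Proof.
move=> x0; have := enorm_sqr x; rewrite x0 expr0n/= => /esym/eqP.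
rewrite psumr_eq0 => [/allP x0'|k _]; last by rewrite -expr2 sqr_ge0.
apply/rowP => k; rewrite mxE; apply/eqP.
by have := x0' k; rewrite mem_index_enum mulf_eq0 orbb => /(_ isT).
Qed.

Lemma rdotZ (a b : R) x y : rdot (a *: x) (b *: y) = a * b * rdot x y.
Proof. by rewrite /rdot mulr_sumr; apply: eq_bigr => k _; rewrite !mxE; ring. Qed.

Lemma enormB_sqr x y :
  enorm (x - y) ^+ 2 = enorm x ^+ 2 + enorm y ^+ 2 - 2 * rdot x y.
Proof.
rewrite !enorm_sqr /rdot mulr_sumr -big_split -sumrB/=.
by apply: eq_bigr => k _; rewrite !mxE; ring.
Qed.

Lemma enormZ (a : R) x : enorm (a *: x) ^+ 2 = a ^+ 2 * enorm x ^+ 2.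
Proof. by rewrite !enorm_sqr rdotZ expr2. Qed.

Definition complexify x : 'rV[R[i]]_n := map_mx (fun t => t%:C%C) x.

Lemma herm_complexify x y : herm (complexify x) (complexify y) = (rdot x y)%:C%C.
Proof.
rewrite /rdot rmorph_sum; apply: eq_bigr => k _.
by rewrite !mxE conjc_real -real_complexM.
Qed.

Lemma hnorm_complexify x : hnorm (complexify x) ^+ 2 = enorm x ^+ 2.
Proof. by apply: complexI; rewrite -hermE herm_complexify enorm_sqr. Qed.

(** The passage from the Poincaré model to the Klein model, followed by the inclusion of real
    vectors into complex ones, so that the Gram and midpoint results for [ckernel] apply. *)
Definition klein x := complexify ((2 / (1 + enorm x ^+ 2)) *: x).

Let den_gt0 x : 0 < 1 + enorm x ^+ 2.
Proof. by rewrite ltr_wpDr ?sqr_ge0. Qed.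

Lemma defect_klein x :
  defect (klein x) = ((1 - enorm x ^+ 2) / (1 + enorm x ^+ 2)) ^+ 2.
Proof.
by rewrite /defect hnorm_complexify enormZ; field; rewrite gt_eqF.
Qed.

Lemma lorentz_klein x y : lorentz (klein x) (klein y) =
  (((1 - enorm x ^+ 2) * (1 - enorm y ^+ 2) + 2 * enorm (x - y) ^+ 2) /
   ((1 + enorm x ^+ 2) * (1 + enorm y ^+ 2)))%:C%C.
Proof.
rewrite /lorentz herm_complexify -real_complexB rdotZ enormB_sqr.
by congr (_%:C%C); field; rewrite !gt_eqF.
Qed.

(** The hyperbolic cosine of the Poincaré distance. Hence [(1 + k) / 2] is the inverse of the
    argument of the logarithm in [potentialG]. *)
Lemma ckernel_klein x y : enorm x < 1 -> enorm y < 1 ->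
  ckernel (klein x) (klein y) =
  1 + 2 * enorm (x - y) ^+ 2 / ((1 - enorm x ^+ 2) * (1 - enorm y ^+ 2)).
Proof.
move=> x1 y1.
have x2 : 0 < 1 - enorm x ^+ 2 by rewrite subr_gt0 expr_lt1 ?enorm_ge0.
have y2 : 0 < 1 - enorm y ^+ 2 by rewrite subr_gt0 expr_lt1 ?enorm_ge0.
rewrite /ckernel lorentz_klein !defect_klein -exprMn sqrtr_sqr normc_real.
have xy0 := mulr_gt0 x2 y2; have dxy := mulr_gt0 (den_gt0 x) (den_gt0 y).
have num0 : 0 <= (1 - enorm x ^+ 2) * (1 - enorm y ^+ 2) + 2 * enorm (x - y) ^+ 2.
  by rewrite addr_ge0 ?(ltW xy0)// mulr_ge0 ?sqr_ge0.
rewrite !ger0_norm; last 2 first.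
- by rewrite mulr_ge0// divr_ge0// ltW.
- by rewrite divr_ge0// ltW.
by field; rewrite !gt_eqF.
Qed.

(** Brings the midpoint back to the Poincaré model. Along the line of [v] the equation
    [2 x / (1 + |x|^2) = v] is quadratic, and its root in the ball is [v / (1 + s)] with
    [s = sqrt (1 - |v|^2)]. *)
Lemma klein_onto v : enorm v < 1 -> exists2 x, enorm x < 1 & klein x = complexify v.
Proof.
move=> v1; have v2 : 0 < 1 - enorm v ^+ 2 by rewrite subr_gt0 expr_lt1 ?enorm_ge0.
pose s := Num.sqrt (1 - enorm v ^+ 2).
have s0 : 0 < s by rewrite sqrtr_gt0.
have s2 : s ^+ 2 = 1 - enorm v ^+ 2 by rewrite sqr_sqrtr// ltW.
have s1 : 0 < 1 + s by lra.
have xE : enorm ((1 + s)^-1 *: v) ^+ 2 = (1 - s) / (1 + s).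
  rewrite enormZ (_ : enorm v ^+ 2 = 1 - s ^+ 2); last by rewrite s2; ring.
  by field; rewrite gt_eqF.
exists ((1 + s)^-1 *: v).
  by rewrite -(@expr_lt1 _ 2) ?enorm_ge0// xE ltr_pdivrMr//; lra.
rewrite /klein xE scalerA (_ : _ * _ = 1) ?scale1r//.
by field; rewrite !gt_eqF//; lra.
Qed.

(** If the images agree, [ckernel_klein] takes the same value at [(x, y)] and at [(x, x)], which
    forces [enorm (x - y) = 0]. *)
Lemma klein_inj x y : enorm x < 1 -> enorm y < 1 -> klein x = klein y -> x = y.
Proof.
move=> x1 y1 xy; have := ckernel_klein x1 y1; rewrite -xy ckernel_klein//.
rewrite subrr enorm0 expr0n/= mulr0 mul0r => /addrI/esym/eqP.
have x2 : 0 < 1 - enorm x ^+ 2 by rewrite subr_gt0 expr_lt1 ?enorm_ge0.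
have y2 : 0 < 1 - enorm y ^+ 2 by rewrite subr_gt0 expr_lt1 ?enorm_ge0.
rewrite mulf_eq0 invr_eq0 (gt_eqF (mulr_gt0 x2 y2)) orbF mulf_eq0 pnatr_eq0/=.
by rewrite sqrf_eq0 => /eqP/enorm_eq0/subr0_eq.
Qed.

Lemma enormB_continuous x : continuous (fun y => enorm (x - y) ^+ 2).
Proof.
rewrite (_ : (fun _ => _) = fun y => \sum_(k < n) (x 0 k - y 0 k) ^+ 2).
  apply: continuous_big => [|k _ y]; first exact: add_continuous.
  have dist_cvg : x 0 k - z 0 k @[z --> y] --> x 0 k - y 0 k.
    by apply: cvgB; [exact: cvg_cst|exact: coord_continuous].
  exact: (cvgM dist_cvg dist_cvg).
by apply/funext => y; rewrite enorm_sqr; apply: eq_bigr => k _; rewrite !mxE expr2.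
Qed.

Lemma enorm_sqr_continuous : continuous (fun x => enorm x ^+ 2).
Proof.
rewrite (_ : (fun _ => _) = fun x => enorm (0 - x) ^+ 2).
  exact: enormB_continuous.
by apply/funext => x; rewrite sub0r -scaleN1r enormZ sqrrN expr1n mul1r.
Qed.

Lemma enorm_ball_compact r : r < 1 ->
  compact [set x : rball R n | enorm (rval x) ^+ 2 <= r].
Proof.
move=> r1; pose K := [set x : 'rV[R]_n | enorm x ^+ 2 <= r].
have KA : K `<=` [set x | enorm x < 1].
  move=> x Kx /=; rewrite -(@expr_lt1 _ 2) ?enorm_ge0//.
  exact: le_lt_trans Kx r1.
apply: (@compact_set_type _ _ K KA).
apply: (@subclosed_compact _ _
  [set x : 'rV[R]_n | forall k, `[-1, 1]%classic (x ord0 k)]).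
- rewrite (_ : K = (fun x => enorm x ^+ 2) @^-1` [set t | t <= r])//.
  by apply: closed_comp => [x _|]; [exact: enorm_sqr_continuous|exact: closed_le].
- exact: (@rV_compact R n (fun=> `[-1, 1]%classic) (fun=> @segment_compact R _ _)).
- move=> x Kx k; rewrite /= in_itv/= -ler_norml -(@expr_le1 _ 2)//.
  rewrite real_normK ?num_real//; apply: le_trans (ltW r1); apply: le_trans Kx.
  rewrite enorm_sqr /rdot (bigD1 k)//= expr2 lerDl.
  by rewrite sumr_ge0// => j _; rewrite -expr2 sqr_ge0.
Qed.

End klein_model.

(** * The potential on the real ball *)

Section real_ball.
Variables (R : realType) (n : nat).
Local Notation k :=
  (fun x y : rball R n => ckernel (klein (rval x)) (klein (rval y))).

Lemma continuous_rval (f : 'rV[R]_n -> R) :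
  continuous f -> continuous (fun x : rball R n => f (rval x)).
Proof.
move=> cf x; apply: (@continuous_comp _ _ _ (@rval R n)); last exact: cf.
exact: initial_continuous.
Qed.

Lemma rval_inj : injective (@rval R n).
Proof. exact: val_inj. Qed.

Lemma rball_lt1 (x : rball R n) : enorm (rval x) < 1.
Proof. exact: set_valP x. Qed.

Lemma rball_sqr_lt1 (x : rball R n) : 0 < 1 - enorm (rval x) ^+ 2.
Proof. by rewrite subr_gt0 expr_lt1 ?enorm_ge0 ?rball_lt1. Qed.

Lemma rball_defect (x : rball R n) : 0 < defect (klein (rval x)).
Proof.
by rewrite defect_klein exprn_gt0// divr_gt0 ?rball_sqr_lt1// ltr_wpDr ?sqr_ge0.
Qed.

Lemma rkernelE (x y : rball R n) : k x y = 1 + 2 * enorm (rval x - rval y) ^+ 2 /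
  ((1 - enorm (rval x) ^+ 2) * (1 - enorm (rval y) ^+ 2)).
Proof. exact: (ckernel_klein (rball_lt1 x) (rball_lt1 y)). Qed.

Lemma rkernel_cvg (x : rball R n) : k x y @[y --> x] --> (1 : R).
Proof.
rewrite (_ : (fun y => _) = fun y : rball R n =>
  1 + enorm (rval x - rval y) ^+ 2 /
  ((1 - enorm (rval x) ^+ 2) / 2 * (1 - enorm (rval y) ^+ 2))); last first.
  by apply/funext => y; rewrite rkernelE; field; rewrite !gt_eqF ?rball_sqr_lt1.
apply: cvg_one_plus_quotient.
- exact: (continuous_rval (@enormB_continuous R n (rval x))).
- exact: (continuous_rval (@enorm_sqr_continuous R n)).
- by rewrite subrr enorm0 expr0n.
- by rewrite gt_eqF ?divr_gt0 ?rball_sqr_lt1.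
- by rewrite gt_eqF ?rball_sqr_lt1.
Qed.

Lemma rkernel_compact N : compact [set x | k point x <= N].
Proof.
have [N1|N1] := ltP N 1.
  rewrite (_ : [set _ | _] = set0); first exact: compact0.
  apply/seteqP; split => // x /=; rewrite leNgt (lt_le_trans N1)//.
  by rewrite ckernel_ge1 ?rball_defect.
(* At the origin the kernel is [(1 + |x|^2) / (1 - |x|^2)]; solve for [|x|^2]. *)
have kNE x : (k point x <= N) = (enorm (rval x) ^+ 2 <= (N - 1) / (N + 1)).
  have x1 := rball_sqr_lt1 x.
  rewrite rkernelE (_ : rval point = 0)// sub0r -scaleN1r enormZ sqrrN expr1n.
  rewrite enorm0 expr0n/= subr0 !mul1r -lerBrDl ler_pdivrMr//.
  by rewrite ler_pdivlMr; [apply/idP/idP; lra|lra].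
rewrite (_ : [set x | k point x <= N] =
    [set x : rball R n | enorm (rval x) ^+ 2 <= (N - 1) / (N + 1)]).
  by apply: enorm_ball_compact; rewrite ltr_pdivrMr; lra.
by apply/seteqP; split => x /=; rewrite kNE.
Qed.

(** The Lorentz product of two Klein points is a nonnegative real, so the phase is 1 and the weights
    are real. The complex midpoint is then a real vector, and [klein_onto] gives its preimage in the
    real ball. *)
Lemma rkernel_strict_midpoint (x x' : rball R n) : x <> x' ->
  exists u, forall y, k u y ^+ 2 < k x y * k x' y.
Proof.
move=> xx'; have [x1 x'1] := (rball_lt1 x, rball_lt1 x').
have [] := @ckernel_midpoint _ _ (klein (rval x)) (klein (rval x')) 1.
- exact: rball_defect.
- exact: rball_defect.
- by move=> /(klein_inj x1 x'1)/rval_inj.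
- exact: ComplexField.Normc.normc1.
- rewrite mul1r lorentz_klein normc_real ger0_norm//.
  have [x2 x'2] := (rball_sqr_lt1 x, rball_sqr_lt1 x').
  apply: divr_ge0; last by rewrite mulr_ge0// addr_ge0// sqr_ge0.
  by rewrite addr_ge0// mulr_ge0 ?sqr_ge0// ltW.
rewrite mul1r; set a := Num.sqrt _; set b := Num.sqrt _.
pose s (y : 'rV[R]_n) : R := 2 / (1 + enorm y ^+ 2).
pose v := (a + b)^-1 *: (a *: (s (rval x) *: rval x) + b *: (s (rval x') *: rval x')).
have -> : (a%:C%C + b%:C%C)^-1 *:
    (a%:C%C *: klein (rval x) + b%:C%C *: klein (rval x')) = complexify v.
  apply/rowP => i; rewrite !mxE.
  by rewrite -!real_complexM -!rmorphD -fmorphV -rmorphM.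
move=> v1 vlt; have [|u u1 uv] := @klein_onto _ _ v.
  by rewrite -(@expr_lt1 _ 2) ?enorm_ge0// -hnorm_complexify -subr_gt0.
exists (exist _ u (mem_set u1) : rball R n) => y.
by have := vlt _ (rball_defect y); rewrite -uv.
Qed.

Lemma potentialG_unique_minimum (mu : {measure set (borel (rball R n)) -> \bar R})
    (A : set (borel (rball R n))) :
  measurable A -> (0 < mu A)%E -> (mu A < +oo)%E ->
  (exists x : rball R n, (potentialG mu A x < +oo)%E) ->
  has_unique_minimum (potentialG mu A).
Proof.
move=> mA A0 Afin.
have k_ge1 x y : 1 <= k x y by rewrite ckernel_ge1 ?rball_defect.
have -> : potentialG mu A =
    fun x => (\int[mu]_(y in A) (ln ((1 + k x y) / 2))%:E)%E.
  apply/funext => x; rewrite /potentialG.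
  apply: oppe_integral_ln => y.
    by have := k_ge1 x y; lra.
  have [x1 y1] := (rball_sqr_lt1 x, rball_sqr_lt1 y).
  have xy1 := mulr_gt0 x1 y1.
  have d0 : 0 < enorm (rval x - rval y) ^+ 2 +
      (1 - enorm (rval x) ^+ 2) * (1 - enorm (rval y) ^+ 2).
    by rewrite ltr_wpDl ?sqr_ge0.
  rewrite rkernelE (mulrC (1 - enorm (rval y) ^+ 2)); field.
  by rewrite !gt_eqF//=; lra.
apply: (@ln_half_kernel_unique_minimum _ _ _ point) => //.
- by move=> x y; rewrite ckernelC.
- by move=> x x' y; rewrite ckernel_gram ?rball_defect.
- exact: rkernel_cvg.
- exact: rkernel_compact.
- exact: rkernel_strict_midpoint.
Qed.

End real_ball.

Theorem theorem3p1 (R : realType) :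
  (forall (n : nat) (mu : {measure set (borel (rball R n)) -> \bar R})
      (A : set (borel (rball R n))),
    lusinN mu (@moebius R n) ->
    measurable A -> (0 < mu A)%E -> (mu A < +oo)%E ->
    (exists x : rball R n, (potentialG mu A x < +oo)%E) ->
    has_unique_minimum (potentialG mu A)) /\
  (forall (m : nat) (mu : {measure set (borel (cball R m)) -> \bar R})
      (A : set (borel (cball R m))),
    lusinN mu (@holomorphic_automorphism R m) ->
    measurable A -> (0 < mu A)%E -> (mu A < +oo)%E ->
    (exists z : cball R m, (potentialL mu A z < +oo)%E) ->
    has_unique_minimum (potentialL mu A)).
Proof.
split=> [n|m] mu A _; first exact: potentialG_unique_minimum.
exact: potentialL_unique_minimum.
Qed.
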